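(* Let $k\ge1$ and let $\lambda=(\lambda_0,\lambda_1,\dots,\lambda_{k-1})$ be a nonzero sequence of real numbers such that $\sum_{\ell=0}^{k-1}\lambda_\ell=0$, and set $\mu_\ell=\lambda_0+\dots+\lambda_\ell$ for $\ell=0,\dots,k-1$, $\mu=(\mu_0,\dots,\mu_{k-1})$. Then $$1+\operatorname{sgnvar}(\mu)\le\operatorname{sgnvar}(\lambda)$$ and $$\operatorname{sgnvar}(\lambda)\equiv 1+\operatorname{sgnvar}(\mu)\pmod 2.$$ In addition, if $\lambda$ is an integer sequence and $V=\sum_{\lambda_\ell>0}\lambda_\ell$, then $$1+\operatorname{sgnvar}(\mu)\le V.$$
   Context: For a finite real sequence $c=(c_0,\dots,c_r)$, $\operatorname{sgnvar}(c)$ is the number of pairs of indices $i<j$ with $c_ic_j<0$ and $c_\ell=0$ for all $i<\ell<j$. *)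

(* Defs.v *)
From mathcomp Require Import all_boot all_order all_algebra.
From mathcomp Require Import reals.

Set Implicit Arguments.
Unset Strict Implicit.
Unset Printing Implicit Defensive.

Import Order.TTheory GRing.Theory Num.Theory.
Local Open Scope ring_scope.

(* A finite real sequence (c_0, ..., c_{n-1}) is a function 'I_n -> R. *)

Definition sgnvar (R : realType) (n : nat) (c : 'I_n -> R) : nat :=
  #|[set p : 'I_n * 'I_n |
      [&& (p.1 < p.2)%N, c p.1 * c p.2 < 0
        & [forall l : 'I_n, (p.1 < l < p.2)%N ==> (c l == 0)]]]|.

Definition partial_sums (R : realType) (n : nat) (c : 'I_n -> R) : 'I_n -> R :=
  fun l => \sum_(j < n | (j <= l)%N) c j.

(* Main.v *)
Require Import Defs.
From mathcomp Require Import all_boot all_order all_algebra.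
From mathcomp Require Import reals.
From mathcomp Require Import zify lra.

Set Implicit Arguments.
Unset Strict Implicit.
Unset Printing Implicit Defensive.

Import Order.TTheory GRing.Theory Num.Theory.
Local Open Scope ring_scope.

(** Both sign-variation numbers can be computed by reading the sequences from
    left to right while remembering only the sign of the last nonzero entry
    ([last_sg], [sign_changes], [sgnvar_sign_changes]).  Each assertion is then
    an invariant of the simultaneous reading of lambda and its partial sums mu.

    Let [a] and [b] be the last nonzero signs seen in lambda and mu, and [p],
    [q] the numbers of changes counted so far.  For mu to pass from one sign to
    the other, or to come back to zero, lambda must first take the sign
    opposite to [b]; hence [q + [a b < 0] <= p], where the inner bracket is 1
    if [a b < 0] and 0 otherwise.  Each change in lambda flips [a] and each
    change in mu flips [b], so that the two sides also keep the same parity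
    ([sign_changes_psum]).  At the end mu vanishes, so the last nonzero step of
    lambda went against [b]: the inner bracket is 1, which gives the inequality
    and the congruence.

    For integer sequences, [V] is half of the total variation of the walk mu,
    since the steps add up to zero.  The walk spends at least 1 to leave zero,
    at least 2 for each change of sign (from [<= -1] to [>= 1] or back), and
    at least 1 to come back to zero, so [2 V >= 2 + 2 q]
    ([sign_changes_variation]). *)

(** * Reading off sign changes from left to right *)

Section Reading.
Variable R : realDomainType.
Implicit Types (f : nat -> R) (n : nat).

(** The value 0 encodes that no nonzero entry has been met yet, so that the
    first nonzero entry is never counted as a change. *)
Fixpoint last_sg f n : R :=
  if n is n'.+1 then if f n' == 0 then last_sg f n' else Num.sg (f n') else 0.

Fixpoint sign_changes f n : nat :=
  if n is n'.+1 then sign_changes f n' + (last_sg f n' * f n' < 0)%R else 0%N.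

Lemma last_sgP f n : [\/ last_sg f n = 0, last_sg f n = 1 | last_sg f n = -1].
Proof.
elim: n => [|n IHn] /=; first by constructor 1.
by case: sgrP => // _; [constructor 2|constructor 3].
Qed.

Lemma last_sg_eq0 f n : last_sg f n = 0 -> forall i, (i < n)%N -> f i = 0.
Proof.
elim: n => [//|n IHn] /=; case: eqVneq => [fn0 last0 i|fn_neq0 /eqP].
  by rewrite ltnS leq_eqVlt => /predU1P[->//|/(IHn last0)].
by rewrite sgr_eq0 (negPf fn_neq0).
Qed.

Definition zero_between f i j := \big[andb/true]_(l < j | (i < l)%N) (f l == 0).

(** At most one earlier index can be paired with an entry [y] at position [j],
    namely that of the last nonzero entry before [j]. *)
Lemma sum_partners f j y :
  (\sum_(i < j) ((f i * y < 0)%R && zero_between f i j : nat))%N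
    = (last_sg f j * y < 0)%R.
Proof.
have zbS n i : (i < n)%N ->
    zero_between f i n.+1 = zero_between f i n && (f n == 0).
  by move=> lt_in; rewrite /zero_between [LHS]big_mkcond big_ord_recr /= lt_in
     -big_mkcond.
elim: j => [|n IHn]; first by rewrite big_ord0 mul0r ltxx.
rewrite big_ord_recr /=.
have -> : zero_between f n n.+1.
  by rewrite /zero_between big_pred0 // => l; have := ltn_ord l; lia.
rewrite andbT; under eq_bigr => i _ do rewrite zbS //.
case: eqVneq => [->|fn_neq0].
  under eq_bigr => i _ do rewrite andbT.
  by rewrite IHn mul0r ltxx addn0.
rewrite big1 ?add0n => [|i _]; last by rewrite !andbF.
by rewrite -[LHS]/(nat_of_bool _) -sgr_lt0 sgrM -[in RHS]sgr_lt0 sgrM sgr_id.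
Qed.

Lemma sign_changesE f n :
  sign_changes f n = (\sum_(j < n) (last_sg f j * f j < 0)%R)%N.
Proof. by elim: n => [|n IHn]; rewrite ?big_ord0 // big_ord_recr -IHn. Qed.

End Reading.

Lemma sgnvar_sign_changes (R : realType) n (c : 'I_n -> R) (f : nat -> R) :
  (forall i, c i = f i) -> sgnvar c = sign_changes f n.
Proof.
move=> cE; rewrite sign_changesE /sgnvar cardsE -sum1_card.
rewrite big_mkcond /= -(pair_bigA_idem _ (fun i j : 'I_n =>
  if [&& (i < j)%N, c i * c j < 0
       & [forall l : 'I_n, (i < l < j)%N ==> (c l == 0)]] then 1%N else 0%N)) //=.
rewrite exchange_big /=; apply: eq_bigr => j _.
rewrite -sum_partners (big_ord_widen n (fun i =>
  ((f i * f j < 0)%R && zero_between f i j : nat)) (ltnW (ltn_ord j))).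
rewrite [RHS]big_mkcond; apply: eq_bigr => i _ /=.
case: ltnP => //= lt_ij; rewrite !cE.
suff -> : [forall l : 'I_n, (i < l < j)%N ==> (c l == 0)] = zero_between f i j.
  by case: (_ && _).
rewrite /zero_between (big_ord_widen_cond n (fun l => i < l)%N
  (fun l => f l == 0) (ltnW (ltn_ord j))) big_andE.
by apply: eq_forallb => l; rewrite cE.
Qed.

(** * Comparing a sequence with its partial sums *)

Definition psum (R : nmodType) (f : nat -> R) n := \sum_(i < n) f i.

Lemma psumS (R : nmodType) (f : nat -> R) n : psum f n.+1 = psum f n + f n.
Proof. exact: big_ord_recr. Qed.

(** The second clause records where the partial sums stand: either they have
    the sign [b], or they have just come back to zero, which they can only do by
    a step against [b].  It determines how a step can move [a] and [b], and at a
    zero total sum it gives [a b < 0] as soon as the signs are nonzero. *)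
Lemma sign_changes_psum (R : realDomainType) (f : nat -> R) n :
  let g i := psum f i.+1 in
  let a := last_sg f n in let b := last_sg g n in
  let p := sign_changes f n in let q := (sign_changes g n + (a * b < 0)%R)%N in
  [/\ (a == 0) = (b == 0), Num.sg (psum f n) = b \/ psum f n = 0 /\ a = - b,
      (q <= p)%N & odd q = odd p].
Proof.
move=> g; elim: n => [|n] /=.
  by rewrite /psum big_ord0 sgr0 mul0r ltxx eqxx; split; auto.
have gn : g n = psum f n + f n := psumS f n.
rewrite psumS gn.
move: (last_sg f n) (last_sgP f n) (last_sg g n) (last_sgP g n) => a aP b bP.
move: (sign_changes f n) (sign_changes g n) (psum f n) (f n) => p q m x {g gn}.
case=> ab0 mP le_qp odd_qp.
(* The new state depends only on [a], [b] and the signs of the current sum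
   [m], of the step [x] and of [m + x]; linear arithmetic discards the
   incompatible combinations. *)
have simpl01 := (@ltr10 R, @ltr01 R, @ltrN10 R, ltr0N1).
case: aP bP ab0 mP le_qp odd_qp => -> [] ->; rewrite ?oppr_eq0 ?oner_eq0 ?eqxx //
  => _; rewrite ?(mulr0, mul1r, mulr1, mulN1r, opprK) ?simpl01 ?ltxx
  => mP le_qp odd_qp.
all: case: (sgrP m) mP => hm [?|[? ?]]; try lra.
all: case: (sgrP x) => hx; case: (sgrP (m + x)) => hmx; try lra.
all: rewrite ?(mulr0, mul0r, mulr1, mul1r, mulN1r, opprK, oppr_lt0)
  ?simpl01 ?ltxx.
all: rewrite ?hmx ?(lt_gtF hmx) ?hx ?(lt_gtF hx) ?ltxx
  ?oppr_eq0 ?oner_eq0 ?eqxx.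
all: split; [by [] | by auto | lia | lia].
Qed.

(** A potential argument: the term [|psum f n - b|], with [b] the last nonzero
    sign of the walk, grows by at most the length of each step that leaves [b]
    unchanged.  When an integer walk changes sign and reaches [y], the distance
    to the old sign is [|y| + 1] while the distance to the new one is [|y| - 1]:
    the drop of 2 pays for the change.  The term [|b|] is 1 as soon as the walk
    has left zero, and back at zero the distance to [b] contributes another 1. *)
Lemma sign_changes_variation (R : archiRealDomainType) (f : nat -> R) n :
    (forall i, f i \is a Num.int) ->
  let g i := psum f i.+1 in
  2 * (sign_changes g n)%:R + `|last_sg g n| + `|psum f n - last_sg g n|
    <= \sum_(i < n) `|f i|.
Proof.
move=> f_int /=; set g := fun i => psum f i.+1.
elim: n => [|n IHn] /=.
  by rewrite /psum !big_ord0 mulr0 subr0 normr0 !addr0.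
rewrite big_ord_recr /=.
have S_int : psum f n.+1 \is a Num.int by apply: rpred_sum => i _.
have ge1 : psum f n.+1 != 0 -> 1 <= `|psum f n.+1| by exact: norm_intr_ge1.
have gn : g n = psum f n + f n := psumS f n.
move: S_int ge1; rewrite psumS gn => _ ge1.
move: (last_sg g n) (last_sgP g n) IHn => b bP IHn.
move: (sign_changes g n) (psum f n) (f n) ge1 IHn => {g gn} q m x ge1 IHn.
have := ler_normD (m - b) x; rewrite addrAC => tri.
have [mx0|mx_neq0] := eqVneq (m + x) 0.
  by move: tri; rewrite mx0 mulr0 ltxx addn0; lra.
have {ge1} := ge1 mx_neq0; rewrite normr_sg mx_neq0.
rewrite natrD mulrDr; move: tri; move: (m + x) mx_neq0 => y y_neq0 tri.
have := ler_norm (y - b); have := ler_norm (b - y); rewrite [`|b - y|]distrC.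
case: (sgrP y) y_neq0 => [-> /eqP//|y_gt0 _|y_lt0 _] => leN leP y_ge1.
- have -> : `|y - 1| = y - 1 by rewrite ger0_norm // subr_ge0.
  case: bP leN leP IHn tri => ->;
    rewrite ?(mul0r, mul1r, mulN1r, normrN, normr0, normr1, oppr_lt0) ?ltxx;
    rewrite ?y_gt0 ?(lt_gtF y_gt0) /=; lra.
- have -> : `|y - -1| = - y - 1 by rewrite opprK ler0_norm; lra.
  case: bP leN leP IHn tri => ->;
    rewrite ?(mul0r, mul1r, mulN1r, normrN, normr0, normr1, oppr_lt0) ?ltxx;
    rewrite ?y_lt0 ?(lt_gtF y_lt0) /=; lra.
Qed.

Theorem proposition2p12 (R : realType) (k : nat) (hk : (1 <= k)%N)
    (lambda : 'I_k -> R)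
    (lambda_neq0 : exists l : 'I_k, lambda l != 0)
    (lambda_sum0 : \sum_(l < k) lambda l = 0) :
  let mu := partial_sums lambda in
  [/\ (1 + sgnvar mu <= sgnvar lambda)%N,
      sgnvar lambda = 1 + sgnvar mu %[mod 2]
    & (forall l : 'I_k, lambda l \is a Num.int) ->
      let V := \sum_(l < k | 0 < lambda l) lambda l in
      (1 + sgnvar mu)%:R <= V].
Proof.
move=> mu.
pose f i := if insub i is Some l then lambda l else 0.
have fE l : lambda l = f l by rewrite /f valK.
pose g n := psum f n.+1.
have gE l : mu l = g l.
  rewrite /mu /partial_sums /g /psum (big_ord_widen k f (ltn_ord l)).
  by apply: eq_bigr => j _.
have sum0 : \sum_(i < k) f i = 0 by rewrite -[RHS]lambda_sum0; exact: eq_bigr.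
rewrite (sgnvar_sign_changes fE) (sgnvar_sign_changes gE).
have := sign_changes_psum f k; rewrite /= {1 2}/psum sum0 -/g sgr0.
case=> ab0 abP le_qp odd_qp.
have a_neq0 : last_sg f k != 0.
  apply/eqP => a0; have [l /eqP[]] := lambda_neq0.
  by rewrite fE (last_sg_eq0 a0).
have b_neq0 : last_sg g k != 0 by rewrite -ab0.
have ab : last_sg f k = - last_sg g k.
  by case: abP => [b0|[]//]; rewrite -b0 eqxx in b_neq0.
have ab_lt0 : last_sg f k * last_sg g k < 0.
  by rewrite ab mulNr oppr_lt0 -expr2 exprn_even_gt0.
move: le_qp odd_qp; rewrite ab_lt0 addnC => le_qp odd_qp.
split=> //; first by rewrite !modn2 odd_qp.
move=> lambda_int /=; set V := \sum_(l < k | _) _.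
have f_int i : f i \is a Num.int.
  by rewrite /f; case: insub => [l|]; rewrite ?lambda_int ?rpred0.
(* Since the entries add up to 0, adding their sum to the sum of their
   absolute values keeps the positive ones only, counted twice. *)
have variationE : \sum_(i < k) `|f i| = V + V.
  rewrite -[LHS]addr0 -[X in _ + X]sum0 -big_split /V -big_split /=.
  rewrite [RHS]big_mkcond; apply: eq_bigr => i _; rewrite fE.
  by case: ltrP => [/gtr0_norm->//|/ler0_norm->]; rewrite addNr.
have b_norm : `|last_sg g k| = 1.
  by case: (last_sgP g k) b_neq0 => ->; rewrite ?eqxx ?normrN ?normr1.
have : 2 * (sign_changes g k)%:R + 1 + 1 <= V + V.
  rewrite -variationE; have := sign_changes_variation k f_int.
  by rewrite /= -/g [psum f k]sum0 sub0r normrN b_norm.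
rewrite [in (1 + _)%:R]natrD; lra.
Qed.
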